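(* Fix an inner node $v_i \in J$, an update interval $[\hat t_j,\hat t_{j+1}]$ and a time $t\in[\hat t_j,\hat t_{j+1}]$. Consider the optimization problem $$\min_{(m_i^r(t))_{r:\, v_r\in\tilde c(v_i)}}\ \sum_{r:\,v_r\in\tilde c(v_i)} \mathbb{E}\left[\left(D^{(v_r)}_{\tilde t(v_i,v_r,t)} - m_i^r(t)\right)^2\ \Big|\ \mathcal{F}_{\hat t_j}\right]$$ subject to $$f_{in}^{(i)}(t) = \sum_{r:\,v_r\in\tilde c(v_i)} m_i^r(t)\,\gamma_i^r(t),$$ where $\hat t_j$ is the time until which information is available, $f_{in}^{(i)}(t)$ is the given ingoing flux at $v_i$, and the minimization is over real-valued $\mathcal{F}_{\hat t_j}$-measurable $m_i^r(t)$ (objective and constraint being understood almost surely). Then the optimal choices for $m_i^r(t)$, for each $r$ with $v_r\in\tilde c(v_i)$, are given by $$m_i^r(t) = \mathbb{E}\left[D^{(v_r)}_{\tilde t(v_i,v_r,t)}\ \Big|\ \mathcal{F}_{\hat t_j}\right] + \frac{\gamma_i^r(t)}{\sum_{c:\,v_c\in\tilde c(v_i)}\left(\gamma_i^c(t)\right)^2}\left(f_{in}^{(i)}(t) - \sum_{c:\,v_c\in\tilde c(v_i)}\gamma_i^c(t)\,\mathbb{E}\left[D^{(v_c)}_{\tilde t(v_i,v_c,t)}\ \Big|\ \mathcal{F}_{\hat t_j}\right]\right).$$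
   Context: Network: a finite connected directed tree with a single source $v_0$, a finite set $J$ of inner nodes and a finite set $C$ of end (demand) nodes. Every arc has length $1$, and $v_l$ denotes the end node of arc $l$. For a node $v$, $\tilde p(v)$ is its direct predecessor node and $\tilde c(v)$ is the set of all demand nodes that are successors (descendants) of $v$. For an inner node $v_i$ and a demand node $v_j\in\tilde c(v_i)$, $\eta(v_i,v_j)$ is the sequence of all arcs leading from $v_i$ to $v_j$. Dynamics: on arc $l$ the density $z^{(l)}(x,t)$, $x\in(0,1)$, satisfies $z^{(l)}_t + (\lambda_l(t) z^{(l)})_x + \mu_l(t) z^{(l)} = 0$, with a strictly positive bounded velocity function $\lambda_l$ and a non-negative integrable damping function $\mu_l$; the flux is $f^{(l)}(z,t)=\lambda_l(t)z$. Travel times: $\tilde t(v_i,v_j,t)$ is the time at which a unit leaving node $v_i$ at time $t$ reaches node $v_j$ (for $v_j$ a successor of $v_i$); that is, $\tilde t(v_i,v_i,t)=t$ and, for each arc $l$ on the path, $\int_{\tilde t(v_i,\tilde p(v_l),t)}^{\tilde t(v_i,v_l,t)}\lambda_l(s)\,ds = 1$. Scaling factors: for $v_r\in\tilde c(v_i)$, $$\gamma_i^r(t) := \prod_{l\in\eta(v_i,v_r)} \frac{\lambda_l(\tilde t(v_i,\tilde p(v_l),t))}{\lambda_l(\tilde t(v_i,v_l,t))}\, e^{\int_{\tilde t(v_i,\tilde p(v_l),t)}^{\tilde t(v_i,v_l,t)}\mu_l(s)\,ds}.$$ The variable $m_i^r(t)$ represents the supply (outflow flux of arc $r$) arriving at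 demand node $v_r$ at time $\tilde t(v_i,v_r,t)$. The quantity $f_{in}^{(i)}(t) := f^{(i)}(z^{(i)}(1,t),t)$ is the flux entering node $v_i$ from arc $i$ at time $t$; it is considered as given (known at the time of the decision, i.e. $\mathcal{F}_{\hat t_j}$-measurable). Demand: on a filtered probability space $(\Omega,\mathcal{A},(\mathcal{F}_t)_{t\in[t_0,T]},P)$, for every $v\in C$ the demand $D^{(v)}$ is a Jacobi process with values in $[0,1]$ solving $dD^{(v)}_t = \kappa^{(v)}(\theta^{(v)}(t)-D^{(v)}_t)\,dt + \sigma^{(v)}\sqrt{D^{(v)}_t(1-D^{(v)}_t)}\,dW^{(v)}_t$, where $\kappa^{(v)},\sigma^{(v)}>0$, $\theta^{(v)}$ is a deterministic function, and $W^{(v)}$ is a Brownian motion. The update times satisfy $t_0=\hat t_1<\dots<\hat t_k\le T$. All demand times $\tilde t(v_i,v_r,t)$ considered lie in the time range on which the demand processes and the functions $\lambda_l,\mu_l$ are defined. *)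

(* Defs.v *)
(* MathComp / MathComp-Analysis *)
From HB Require Import structures.
From mathcomp Require Import all_boot all_order all_algebra.
From mathcomp Require Import all_classical all_reals all_analysis.
From mathcomp Require Import measurable_realfun.

Set Implicit Arguments.
Unset Strict Implicit.
Unset Printing Implicit Defensive.

Import Order.TTheory GRing.Theory Num.Theory.
Import numFieldNormedType.Exports.

Local Open Scope classical_set_scope.
Local Open Scope ring_scope.

(** * Network *)

Definition adjacent (V A : finType) (src tgt : A -> V) : rel V :=
  fun u v => [exists l, (src l == u) && (tgt l == v)].

(* The predecessor node of [arc_end l] is [arc_start l]. *)
Record network := Network {
  nodes : finType;
  arcs : finType;
  arc_start : arcs -> nodes;
  arc_end : arcs -> nodes;
  source : nodes;
  source_no_in : forall l, arc_end l != source;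
  unique_in : forall v, v != source -> #|[set l | arc_end l == v]%SET| = 1%N;
  from_source : forall v, connect (adjacent arc_start arc_end) source v }.

Arguments arc_start {n} l.
Arguments arc_end {n} l.

(* Reflexive: every node is its own descendant. *)
Definition descends (N : network) : rel (nodes N) :=
  connect (adjacent (@arc_start N) (@arc_end N)).

Definition has_out (N : network) (v : nodes N) : bool :=
  [exists l : arcs N, arc_start l == v].

Definition inner_nodes (N : network) : {set nodes N} :=
  [set v | (v != source N) && has_out v]%SET.

Definition demand_nodes (N : network) : {set nodes N} :=
  [set v | (v != source N) && ~~ has_out v]%SET.

Definition demand_below (N : network) (v : nodes N) : {set nodes N} :=
  [set u in demand_nodes N | descends v u]%SET.

(* The directed path from [u] to [v] is unique, so that its arcs are those which
   start below [u] and end above [v]; only products over them are taken, whence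
   a set rather than a sequence. *)
Definition path_arcs (N : network) (u v : nodes N) : {set arcs N} :=
  [set l | descends u (arc_start l) && descends (arc_end l) v]%SET.

(** * Transport dynamics, travel times and scaling factors *)

Definition velocity (R : realType) (t0 T : R) (lam : R -> R) : Prop :=
  [/\ measurable_fun `[t0, T] lam,
      forall t, t \in `[t0, T] -> 0 < lam t
    & exists M, forall t, t \in `[t0, T] -> lam t <= M].

Definition damping (R : realType) (t0 T : R) (mu : R -> R) : Prop :=
  lebesgue_measure.-integrable `[t0, T] (EFin \o mu) /\
  (forall t, t \in `[t0, T] -> 0 <= mu t).

Definition flux (R : realType) (lam : R -> R) (zx t : R) : R := lam t * zx.

(* [C^1] in (x, t) and zero for t outside some [a, b] with t0 < a <= b < T. *)
Definition test_function (R : realType) (t0 T : R)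
    (phi phix phit : R * R -> R) : Prop :=
  [/\ continuous phi, continuous phix, continuous phit,
      forall x t : R,
        is_derive x 1 (fun y : R => phi (y, t)) (phix (x, t)) /\
        is_derive t 1 (fun s : R => phi (x, s)) (phit (x, t))
    & exists a b : R, [/\ t0 < a, a <= b, b < T &
        forall x t : R, t \notin `[a, b] -> phi (x, t) = 0]].

(* Weak form of z_t + (lam z)_x + mu z = 0 on ]0, 1[ x ]t0, T[.  Test functions
   need not vanish at x = 0 and x = 1, so that the boundary terms identify
   [lam t * z 0 t] and [lam t * z 1 t] as the fluxes through the two ends. *)
Definition density (R : realType) (t0 T : R) (lam mu : R -> R)
    (z : R -> R -> R) : Prop :=
  let leb := @lebesgue_measure R in
  let strip : set (R * R) := (`]0, 1[ `*` `]t0, T[) in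
  [/\ (leb \x leb)%E.-integrable strip (fun q => (z q.1 q.2)%:E),
      (leb \x leb)%E.-integrable strip (fun q => (mu q.2 * z q.1 q.2)%:E),
      leb.-integrable `[t0, T] (fun t => (flux lam (z 0 t) t)%:E),
      leb.-integrable `[t0, T] (fun t => (flux lam (z 1 t) t)%:E)
    & forall phi phix phit : R * R -> R, test_function t0 T phi phix phit ->
      \int[(leb \x leb)%E]_(q in strip)
         (z q.1 q.2 * phit q + flux lam (z q.1 q.2) q.2 * phix q
          - mu q.2 * z q.1 q.2 * phi q) =
      \int[leb]_(t in `[t0, T])
         (flux lam (z 1 t) t * phi (1, t) - flux lam (z 0 t) t * phi (0, t))].

(* [ttime v u s] is the arrival time at [u] of a unit leaving [v] at time [s];
   the condition concerns the departures from [v] at time [t]. *)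
Definition travel_times (R : realType) (N : network) (lam : arcs N -> R -> R)
    (ttime : nodes N -> nodes N -> R -> R) (v : nodes N) (t : R) : Prop :=
  ttime v v t = t /\
  forall l : arcs N, descends v (arc_start l) ->
    ttime v (arc_start l) t <= ttime v (arc_end l) t /\
    \int[@lebesgue_measure R]_(s in
        `[ttime v (arc_start l) t, ttime v (arc_end l) t]) lam l s = 1.

Definition gamma (R : realType) (N : network) (lam mu : arcs N -> R -> R)
    (ttime : nodes N -> nodes N -> R -> R) (vi vr : nodes N) (t : R) : R :=
  \prod_(l in path_arcs vi vr)
    (lam l (ttime vi (arc_start l) t) / lam l (ttime vi (arc_end l) t) *
     expR (\int[@lebesgue_measure R]_(s in
             `[ttime vi (arc_start l) t, ttime vi (arc_end l) t]) mu l s)).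

(** * Sub-sigma-algebras and conditional expectation *)

Definition filtration (R : realType) (d : measure_display)
    (Omega : measurableType d) (t0 T : R) (F : R -> set (set Omega)) : Prop :=
  [/\ forall t, t \in `[t0, T] -> sigma_algebra setT (F t),
      forall t, t \in `[t0, T] -> F t `<=` measurable
    & forall s t, t0 <= s -> s <= t -> t <= T -> F s `<=` F t].

Definition sub_measurable (d d' : measure_display) (Omega : measurableType d)
    (E : measurableType d') (G : set (set Omega)) (X : Omega -> E) : Prop :=
  measurable_fun [set: g_sigma_algebraType G]
    (X : g_sigma_algebraType G -> E).

Definition is_cond_exp (R : realType) (d : measure_display)
    (Omega : measurableType d) (P : probability Omega R)
    (G : set (set Omega)) (X Y : Omega -> \bar R) : Prop :=
  sub_measurable G Y /\
  forall A, G A -> (\int[P]_(w in A) Y w = \int[P]_(w in A) X w)%E.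

(* A version of E[X | G], for X nonnegative or integrable. *)
Definition cond_exp (R : realType) (d : measure_display)
    (Omega : measurableType d) (P : probability Omega R)
    (G : set (set Omega)) (X : Omega -> \bar R) : Omega -> \bar R :=
  xget (cst 0%E) [set Y | is_cond_exp P G X Y].

(** * Brownian motion, Ito integral, Jacobi process *)

Definition adapted (R : realType) (d : measure_display)
    (Omega : measurableType d) (t0 T : R) (F : R -> set (set Omega))
    (X : R -> Omega -> R) : Prop :=
  forall t, t \in `[t0, T] -> sub_measurable (F t) (X t).

Definition continuous_paths (R : realType) (d : measure_display)
    (Omega : measurableType d) (P : probability Omega R) (t0 T : R)
    (X : R -> Omega -> R) : Prop :=
  {ae P, forall w, {within `[t0, T], continuous (fun t => X t w)}}.

Definition brownian (R : realType) (d : measure_display)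
    (Omega : measurableType d) (P : probability Omega R) (t0 T : R)
    (F : R -> set (set Omega)) (W : R -> Omega -> R) : Prop :=
  [/\ adapted t0 T F W,
      continuous_paths P t0 T W,
      {ae P, forall w, W t0 w = 0}
    & forall s t, t0 <= s -> s < t -> t <= T ->
        forall B : set R, measurable B ->
          let E := (fun w => W t w - W s w) @^-1` B in
          P E = normal_prob 0 (Num.sqrt (t - s)) B /\
          forall A, F s A -> P (A `&` E) = (P A * P E)%E].

(* sum_(k < n) xi_k 1_{]u_k, u_(k+1)]} *)
Record step_process (R : realType) (Omega : Type) := StepProcess {
  steps : nat;
  step_time : nat -> R;
  step_val : nat -> Omega -> R }.

Definition simple_process (R : realType) (d : measure_display)
    (Omega : measurableType d) (F : R -> set (set Omega)) (a b : R)
    (H : step_process R Omega) : Prop :=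
  [/\ a <= step_time H 0, step_time H (steps H) <= b,
      forall k, (k < steps H)%N -> step_time H k <= step_time H k.+1
    & forall k, (k < steps H)%N ->
        sub_measurable (F (step_time H k)) (step_val H k) /\
        exists M, forall w, `|step_val H k w| <= M].

Definition step_eval (R : realType) (Omega : Type) (H : step_process R Omega)
    (s : R) (w : Omega) : R :=
  \sum_(k < steps H)
    step_val H k w * \1_(`]step_time H k, step_time H k.+1]) s.

Definition step_integral (R : realType) (Omega : Type) (W : R -> Omega -> R)
    (H : step_process R Omega) (w : Omega) : R :=
  \sum_(k < steps H)
    step_val H k w * (W (step_time H k.+1) w - W (step_time H k) w).

(* [I] is (a version of) the Ito integral of [H] against [W] over [a, b]. *)
Definition is_ito_integral (R : realType) (d : measure_display)
    (Omega : measurableType d) (P : probability Omega R)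
    (F : R -> set (set Omega)) (W H : R -> Omega -> R) (a b : R)
    (I : Omega -> R) : Prop :=
  measurable_fun setT I /\
  exists S : nat -> step_process R Omega,
    [/\ forall n, simple_process F a b (S n),
        (fun n => \int[@lebesgue_measure R]_(s in `[a, b])
           \int[P]_w ((H s w - step_eval (S n) s w) ^+ 2)%:E)%E
          @ \oo --> 0%E
      & (fun n => \int[P]_w ((I w - step_integral W (S n) w) ^+ 2)%:E)%E
          @ \oo --> 0%E].

(* dD = kappa (theta(t) - D) dt + sigma sqrt(D (1 - D)) dW on [t0, T] *)
Definition jacobi_process (R : realType) (d : measure_display)
    (Omega : measurableType d) (P : probability Omega R) (t0 T : R)
    (F : R -> set (set Omega)) (kappa sigma : R) (theta : R -> R)
    (W D : R -> Omega -> R) : Prop :=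
  [/\ adapted t0 T F D,
      continuous_paths P t0 T D,
      forall t w, t \in `[t0, T] -> 0 <= D t w <= 1,
      (@lebesgue_measure R).-integrable `[t0, T] (EFin \o theta)
    & forall t, t \in `[t0, T] -> exists I : Omega -> R,
        is_ito_integral P F W
          (fun s w => sigma * Num.sqrt (D s w * (1 - D s w))) t0 t I /\
        {ae P, forall w,
          D t w = D t0 w
            + \int[@lebesgue_measure R]_(s in `[t0, t])
                (kappa * (theta s - D s w))
            + I w}].

(** * The optimization problem *)

(* Families [m] are indexed by all nodes; only the entries in [S] matter. *)
Definition feasible (R : realType) (d : measure_display)
    (Omega : measurableType d) (P : probability Omega R)
    (G : set (set Omega)) (V : finType) (S : {set V}) (g : V -> R)
    (f : Omega -> R) (m : V -> Omega -> R) : Prop :=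
  (forall v, v \in S -> sub_measurable G (m v)) /\
  {ae P, forall w, f w = \sum_(v in S) m v w * g v}.

Definition objective (R : realType) (d : measure_display)
    (Omega : measurableType d) (P : probability Omega R)
    (G : set (set Omega)) (V : finType) (S : {set V}) (X : V -> Omega -> R)
    (m : V -> Omega -> R) (w : Omega) : \bar R :=
  (\sum_(v in S) cond_exp P G (fun w => ((X v w - m v w) ^+ 2)%:E) w)%E.

Definition optimal (R : realType) (d : measure_display)
    (Omega : measurableType d) (P : probability Omega R)
    (G : set (set Omega)) (V : finType) (S : {set V}) (X : V -> Omega -> R)
    (g : V -> R) (f : Omega -> R) (m : V -> Omega -> R) : Prop :=
  feasible P G S g f m /\
  forall m', feasible P G S g f m' ->
    {ae P, forall w, (objective P G S X m w <= objective P G S X m' w)%E}.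

(* Main.v *)
Require Import Defs.
From HB Require Import structures.
From mathcomp Require Import all_boot all_order all_algebra.
From mathcomp Require Import all_classical all_reals all_analysis.
From mathcomp Require Import measurable_realfun.
From mathcomp Require Import ring lra.

Set Implicit Arguments.
Unset Strict Implicit.
Unset Printing Implicit Defensive.

Import Order.TTheory GRing.Theory Num.Theory.
Import numFieldNormedType.Exports.

Local Open Scope classical_set_scope.
Local Open Scope ring_scope.

(** Conditionally on the information available, write e_v for the conditional
    mean of the demand X_v.  For every decision m_v known at that time the
    conditional mean square error is

      E[(X_v - m_v)^2 | G] = (m_v - e_v)^2 + s_v,

    where s_v does not depend on m_v ([cond_exp_bias_variance]).  Hence the
    problem is, for almost every outcome, the orthogonal projection of the
    vector e onto the hyperplane { m | sum_v m_v g_v = f }, and the claimed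
    formula is this projection.  By Pythagoras ([sum_sqr_hyperplane]) the
    objective of a feasible m exceeds that of the projection by exactly
    sum_v (m_v - mopt_v)^2, which yields optimality and uniqueness at once
    ([optimal_affine_correction]).

    The decisions m_v need not be square integrable, so both sides of the
    bias-variance identity may have an infinite expectation and the cross term
    m_v X_v cannot be integrated on its own.  Since 0 <= x <= 1, the identity

      (x - m)^2 + x (1 - x) = (1 - m)^2 x + m^2 (1 - x)

    replaces it by products of nonnegative functions, out of which the known
    factors (1 - m)^2 and m^2 can be taken without any integrability; the term
    x (1 - x) is bounded and cancels.  Conditional expectations of bounded
    variables are obtained as Radon-Nikodym densities on the coarser
    sigma-algebra ([cond_density]), and are unique almost everywhere
    ([factor_ae_eq]).

    The projection only exists if the hyperplane has a nonzero normal vector g.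
    The network provides this: it has no directed cycle, so a demand node lies
    below every inner node ([demand_below_nonempty]), and the scaling factors
    are positive because velocities are positive at all the travel times
    involved, which stay in the time range ([gamma_gt0]). *)

(** * Conditional expectation along a measurable map *)

(** Packs a set function as a structured finite measure, so that densities and
    image measures can be fed to the Radon-Nikodym theorem. *)
Lemma finite_measure_of d (T : measurableType d) (R : realType)
    (mu : set T -> \bar R) :
  mu set0 = 0%E -> (forall A, (0 <= mu A)%E) -> semi_sigma_additive mu ->
  fin_num_fun mu ->
  exists nu : {finite_measure set T -> \bar R}, nu = mu :> (set T -> \bar R).
Proof.
move=> mu0 mu_ge0 mu_add mu_fin.
pose mx := isMeasure.Build _ _ _ mu mu0 mu_ge0 mu_add.
pose m : {measure set T -> \bar R} := HB.pack mu mx.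
have m_fin : fin_num_fun m by [].
pose fx := Measure_isFinite.Build _ _ _ m m_fin.
pose nu : {finite_measure set T -> \bar R} := HB.pack mu mx fx.
by exists nu.
Qed.

Lemma measurable_preimage d d' (T : measurableType d)
    (T' : measurableType d') (phi : T -> T') (A : set T') :
  measurable_fun setT phi -> measurable A -> measurable (phi @^-1` A).
Proof. by move=> mphi mA; rewrite -[X in measurable X]setTI; exact: mphi. Qed.

Lemma image_measure d d' (T : measurableType d)
    (T' : measurableType d') (R : realType)
    (mu : {finite_measure set T -> \bar R}) (phi : T -> T') :
  measurable_fun setT phi ->
  exists nu : {finite_measure set T' -> \bar R},
    (forall A, nu A = mu (phi @^-1` A)) /\
    (forall (h : T' -> \bar R) A, measurable_fun setT h -> measurable A ->
      (\int[nu]_(y in A) h y = \int[mu]_(x in phi @^-1` A) h (phi x))%E).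
Proof.
move=> mphi.
have [|A||A mA|nu nuE] := @finite_measure_of _ T' R (pushforward mu phi).
- exact: measure0.
- exact: measure_ge0.
- exact: measure_semi_sigma_additive.
- by apply: fin_num_measure; exact: measurable_preimage.
exists nu; split=> [A|h A mh mA]; first by rewrite nuE.
have nuE' : Measure.sort nu = pushforward mu phi :> (set T' -> \bar R) := nuE.
rewrite integralE [RHS]integralE nuE'.
rewrite !(@ge0_integral_pushforward _ _ _ _ _ _ mphi)//.
- by congr (_ - _)%E; apply: eq_integral => x _; rewrite /= ?funeposE ?funenegE.
- by apply: measurable_funTS; exact: measurable_funeneg.
- by apply: measurable_funTS; exact: measurable_funepos.
Qed.

Lemma weighted_finite_measure d (T : measurableType d) (R : realType)
    (P : {finite_measure set T -> \bar R}) (X : T -> R) :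
  measurable_fun setT X -> (forall x, 0 <= X x <= 1) ->
  exists nu : {finite_measure set T -> \bar R},
    (forall A, nu A = (\int[P]_(x in A) (X x)%:E)%E) /\ nu `<< P.
Proof.
move=> mX X01.
have X0 x : 0 <= X x by have /andP[] := X01 x.
have [|||A mA|nu nuE] :=
  @finite_measure_of _ T R (fun A => \int[P]_(x in A) (X x)%:E)%E.
- by rewrite integral_set0.
- by move=> A; apply: integral_ge0 => x _; rewrite lee_fin.
- by apply: semi_sigma_additive_nng_induced => [|x];
    [exact/measurable_EFinP|rewrite lee_fin].
- rewrite ge0_fin_numE; last by apply: integral_ge0 => x _; rewrite lee_fin.
  apply: (@le_lt_trans _ _ (\int[P]_(x in A) (cst 1 x))%E); last first.
    by rewrite integral_cst// mul1e ltey_eq fin_num_measure.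
  apply: ge0_le_integral => //.
  + by move=> x _; rewrite lee_fin.
  + exact/measurable_EFinP/measurable_funTS.
  + by move=> x _; rewrite lee_fin; have /andP[] := X01 x.
exists nu; split=> [A|]; first by rewrite nuE.
apply/null_content_dominatesP => A mA PA0; rewrite nuE.
by apply: null_set_integral => //; exact/measurable_EFinP/measurable_funTS.
Qed.

(** The density X of nu coincides almost everywhere with the Radon-Nikodym
    derivative, for which the change of variables is known; X itself may be any
    function with the right integrals over measurable sets. *)
Lemma integral_weighted d (T : measurableType d) (R : realType)
    (P nu : {finite_measure set T -> \bar R}) (X : T -> \bar R) :
  measurable_fun setT X -> nu `<< P ->
  (forall A, measurable A -> nu A = (\int[P]_(x in A) X x)%E) ->
  forall (h : T -> \bar R) A, (forall x, (0 <= h x)%E) ->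
    measurable A -> measurable_fun A h ->
    (\int[nu]_(x in A) h x = \int[P]_(x in A) (h x * X x))%E.
Proof.
move=> mX nuP nuE h A h0 mA mh.
rewrite -(Radon_Nikodym_SigmaFinite.change_of_variables nuP)//.
have ifP := Radon_Nikodym_SigmaFinite.f_integrable nuP.
have mf := measurable_int _ ifP.
apply: ae_eq_integral => //.
- by apply: emeasurable_funM => //; exact: measurable_funTS.
- by apply: emeasurable_funM => //; exact: measurable_funTS.
apply: ae_eqe_mul2l; apply: (ae_eq_subset (@subsetT _ A)).
apply: integral_ae_eq => // E _ mE.
by rewrite -Radon_Nikodym_SigmaFinite.f_integral// nuE.
Qed.

(** [e \o phi] is a version of E[X | sigma(phi)].  The weight [h], which may be
    unbounded or infinite, is part of the definition so that known factors can
    be taken out of the conditional expectation without integrability. *)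
Definition is_cond_density d d' (T : measurableType d)
    (T' : measurableType d') (R : realType) (P : set T -> \bar R)
    (phi : T -> T') (X : T -> R) (e : T' -> R) : Prop :=
  forall (h : T' -> \bar R) A, (forall y, (0 <= h y)%E) ->
    measurable A -> measurable_fun setT h ->
    (\int[P]_(x in phi @^-1` A) (h (phi x) * (X x)%:E) =
     \int[P]_(x in phi @^-1` A) (h (phi x) * (e (phi x))%:E))%E.

(** The measure A |-> E[X; phi in A] is absolutely continuous with respect to
    the law of phi; its density is e.  Weights are handled by integrating them
    against this measure, seen once on T' and once on T. *)
Lemma cond_density d d' (T : measurableType d)
    (T' : measurableType d') (R : realType)
    (P : {finite_measure set T -> \bar R})
    (phi : T -> T') (X : T -> R) :
  measurable_fun setT phi -> measurable_fun setT X ->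
  (forall x, 0 <= X x <= 1) ->
  exists e : T' -> R, [/\ measurable_fun setT e, forall y, 0 <= e y &
    is_cond_density P phi X e].
Proof.
move=> mphi mX X01.
have [Q [QE intQ]] := image_measure P mphi.
have [nuX [nuXE nuXP]] := weighted_finite_measure P mX X01.
have [nu [nuE intnu]] := image_measure nuX mphi.
have nuQ : nu `<< Q.
  apply/null_content_dominatesP => A mA QA0; apply: etrans (nuE A) _.
  move/null_content_dominatesP: nuXP; apply; first exact: measurable_preimage.
  exact: etrans (esym (QE A)) QA0.
have [f [f0 ffin fint fE]] := radon_nikodym_sigma_finite nuQ.
have mf := measurable_int _ fint.
exists (fine \o f); split=> [|y|h A h0 mA mh].
- exact: measurableT_comp.
- by rewrite fine_ge0.
transitivity (\int[nu]_(y in A) h y)%E.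
  rewrite intnu// [RHS](@integral_weighted _ _ _ P _ (EFin \o X))//.
  - exact/measurable_EFinP.
  - exact: measurable_preimage.
  - by apply: measurable_funTS; exact: measurableT_comp.
rewrite (@integral_weighted _ _ _ Q nu f)//; last exact: measurable_funTS.
rewrite intQ//; last exact: emeasurable_funM.
by apply: eq_integral => x _ /=; rewrite fineK.
Qed.

(** Both integrals may be infinite, so they are compared on the sets where
    |r| <= n: there r is integrable and the two functions agree almost
    everywhere; these sets exhaust the space because r takes real values. *)
Lemma factor_ae_eq d d' (T : measurableType d)
    (T' : measurableType d') (R : realType)
    (P : {finite_measure set T -> \bar R}) (phi : T -> T')
    (f : T' -> \bar R) (r : T' -> R) :
  measurable_fun setT phi -> measurable_fun setT f -> measurable_fun setT r ->
  (forall A, measurable A ->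
    \int[P]_(x in phi @^-1` A) f (phi x) =
    \int[P]_(x in phi @^-1` A) (r (phi x))%:E)%E ->
  {ae P, forall x, f (phi x) = (r (phi x))%:E}.
Proof.
move=> mphi mf mr fr.
have [Q [QE intQ]] := image_measure P mphi.
have mrE : measurable_fun setT (EFin \o r) by exact/measurable_EFinP.
pose B n := r @^-1` `[- n%:R, n%:R].
have mB n : measurable (B n) by exact: measurable_preimage.
have aeB n : ae_eq Q (B n) (EFin \o r) f.
  apply: integral_ae_eq => //.
  - apply: measurable_bounded_integrable => //.
    + by rewrite ltey_eq fin_num_measure.
    + exact: measurable_funTS.
    + exists n%:R; split=> [|M nM y]; first exact: num_real.
      rewrite /B /= in_itv /= => ry; apply: le_trans (ltW nM).
      by rewrite ler_norml.
  - exact: measurable_funTS.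
  - by move=> E _ mE; rewrite !intQ// fr.
have [N [mN N0 fN]] : {ae Q, forall y n, B n y -> (r y)%:E = f y}.
  exact: ae_foralln.
exists (phi @^-1` N); split; first exact: measurable_preimage.
  exact: etrans (esym (QE N)) N0.
move=> x /= frx; apply: fN => /= H; apply: frx; apply/esym.
apply: (H (Num.truncn `|r (phi x)|).+1).
by rewrite /B /= in_itv /= -ler_norml ltW// truncnS_gt.
Qed.

Lemma is_cond_density_integral d d' (T : measurableType d)
    (T' : measurableType d') (R : realType) (P : probability T R)
    (phi : T -> T') (X : T -> R) (e : T' -> R) (A : set T') :
  is_cond_density P phi X e -> measurable A ->
  (\int[P]_(x in phi @^-1` A) (X x)%:E =
   \int[P]_(x in phi @^-1` A) (e (phi x))%:E)%E.
Proof.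
move=> Xe mA.
have := Xe (cst 1%E) A (fun=> lee01) mA (measurable_cst _).
under eq_integral do rewrite /= mul1e.
by under [in RHS]eq_integral do rewrite /= mul1e.
Qed.

(** Densities e1 of X and e2 of 1 - X are nonnegative and add up to 1 almost
    everywhere, so that truncating e1 at 1 changes it on a null set only.
    Having both X and 1 - X with arbitrary weights is what the bias-variance
    identity uses. *)
Lemma cond_density_01 d d' (T : measurableType d)
    (T' : measurableType d') (R : realType) (P : probability T R)
    (phi : T -> T') (X : T -> R) :
  measurable_fun setT phi -> measurable_fun setT X ->
  (forall x, 0 <= X x <= 1) ->
  exists e : T' -> R, [/\ measurable_fun setT e, forall y, 0 <= e y <= 1,
    is_cond_density P phi X e &
    is_cond_density P phi (fun x => 1 - X x) (fun y => 1 - e y)].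
Proof.
move=> mphi mX X01.
have [e1 [me1 e1_ge0 e1X]] := cond_density P mphi mX X01.
have mX' : measurable_fun setT (fun x => 1 - X x) by exact: measurable_funB.
have X'01 x : 0 <= 1 - X x <= 1 by have /andP[? ?] := X01 x; lra.
have [e2 [me2 e2_ge0 e2X]] := cond_density P mphi mX' X'01.
have mp A : measurable A -> measurable (phi @^-1` A).
  by move=> mA; exact: measurable_preimage.
have me1p : measurable_fun setT (e1 \o phi) by exact: measurableT_comp.
have me2p : measurable_fun setT (e2 \o phi) by exact: measurableT_comp.
have e12 : {ae P, forall x, (e1 (phi x) + e2 (phi x))%:E = 1%E}.
  apply: (@factor_ae_eq _ _ _ _ _ P phi
    (fun y => (e1 y + e2 y)%:E) (cst 1)) => //.
    by apply/measurable_EFinP; exact: measurable_funD.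
  move=> A mA; under eq_integral do rewrite EFinD.
  rewrite ge0_integralD//; last first.
  - by apply/measurable_EFinP/measurable_funTS.
  - by move=> x _; rewrite lee_fin.
  - by apply/measurable_EFinP/measurable_funTS.
  - by move=> x _; rewrite lee_fin.
  - exact: mp.
  rewrite -(is_cond_density_integral e1X)// -(is_cond_density_integral e2X)//.
  rewrite -ge0_integralD//.
  - by apply: eq_integral => x _; rewrite -EFinD /=; congr EFin; lra.
  - exact: mp.
  - by move=> x _; rewrite lee_fin; have /andP[] := X01 x.
  - exact/measurable_EFinP/measurable_funTS.
  - by move=> x _; rewrite lee_fin; have /andP[] := X'01 x.
  - exact/measurable_EFinP/measurable_funTS.
pose e y := Num.min (e1 y) 1.
have me : measurable_fun setT e by exact: measurable_minr.
have mep : measurable_fun setT (e \o phi) by exact: measurableT_comp.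
have ee1 : {ae P, forall x, e (phi x) = e1 (phi x) /\ 1 - e (phi x) = e2 (phi x)}.
  apply: filterS e12 => x [] h.
  have -> : e (phi x) = e1 (phi x).
    by rewrite /e min_l//; have := e2_ge0 (phi x); lra.
  by split=> //; lra.
exists e; split=> // [y|h A h0 mA mh|h A h0 mA mh].
- by rewrite /e le_min e1_ge0 ler01 /= ge_min lexx orbT.
- have mhp : measurable_fun setT (h \o phi) by exact: measurableT_comp.
  rewrite e1X//; apply: ae_eq_integral.
  + exact: mp.
  + by apply: measurable_funTS; apply: emeasurable_funM => //;
      exact/measurable_EFinP.
  + by apply: measurable_funTS; apply: emeasurable_funM => //;
      exact/measurable_EFinP.
  + by apply: filterS ee1 => x [-> _].
- have mhp : measurable_fun setT (h \o phi) by exact: measurableT_comp.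
  rewrite e2X//; apply: ae_eq_integral.
  + exact: mp.
  + by apply: measurable_funTS; apply: emeasurable_funM => //;
      exact/measurable_EFinP.
  + apply: measurable_funTS; apply: emeasurable_funM => //.
    by apply/measurable_EFinP; exact: measurable_funB.
  + by apply: filterS ee1 => x [_ ->].
Qed.

(** * Bias-variance decomposition of the conditional mean square error *)

(** The square is traded for terms in which x enters linearly and with a
    nonnegative coefficient, at the price of x (1 - x), whose integral does not
    involve m. *)
Lemma square_split_integral d (T : measurableType d) (R : realType)
    (P : probability T R) (x m : T -> R) (A : set T) :
  measurable_fun setT x -> (forall w, 0 <= x w <= 1) ->
  measurable_fun setT m -> measurable A ->
  (\int[P]_(w in A) ((x w - m w) ^+ 2)%:E +
   \int[P]_(w in A) (x w * (1 - x w))%:E =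
   \int[P]_(w in A) (((1 - m w) ^+ 2)%:E * (x w)%:E) +
   \int[P]_(w in A) ((m w ^+ 2)%:E * (1 - x w)%:E))%E.
Proof.
move=> mx x01 mm mA.
have x0 w : 0 <= x w by have /andP[] := x01 w.
have x1 w : 0 <= 1 - x w by have /andP[_] := x01 w; rewrite subr_ge0.
rewrite -!ge0_integralD//.
- by apply: eq_integral => w _; rewrite -!EFinM -!EFinD; congr EFin; ring.
- by move=> w _; rewrite lee_fin mulr_ge0// sqr_ge0.
- apply/measurable_EFinP/measurable_funTS; apply: measurable_funM => //.
  by apply: measurable_funX; exact: measurable_funB.
- by move=> w _; rewrite lee_fin mulr_ge0// sqr_ge0.
- apply/measurable_EFinP/measurable_funTS; apply: measurable_funM => //.
  + exact: measurable_funX.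
  + exact: measurable_funB.
- by move=> w _; rewrite lee_fin sqr_ge0.
- apply/measurable_EFinP/measurable_funTS.
  by apply: measurable_funX; exact: measurable_funB.
- by move=> w _; rewrite lee_fin mulr_ge0.
- apply/measurable_EFinP/measurable_funTS; apply: measurable_funM => //.
  exact: measurable_funB.
Qed.

(** Splitting (X - m)^2 and (e - m)^2 in the same way, the right-hand sides have
    equal integrals because e is a conditional density of X and 1 - e one of
    1 - X.  So the integrals of (X - m)^2 and (e - m)^2 differ by a constant
    independent of m, which the choice m = e identifies as that of
    (X - e)^2. *)
Lemma bias_variance d d' (T : measurableType d)
    (T' : measurableType d') (R : realType) (P : probability T R)
    (phi : T -> T') (X : T -> R) :
  measurable_fun setT phi -> measurable_fun setT X ->
  (forall x, 0 <= X x <= 1) ->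
  exists e s : T' -> R, [/\ measurable_fun setT e, measurable_fun setT s,
    forall A, measurable A -> (\int[P]_(x in phi @^-1` A) (X x)%:E =
      \int[P]_(x in phi @^-1` A) (e (phi x))%:E)%E &
    forall (m : T' -> R) A, measurable_fun setT m -> measurable A ->
      (\int[P]_(x in phi @^-1` A) ((X x - m (phi x)) ^+ 2)%:E =
       \int[P]_(x in phi @^-1` A)
         ((m (phi x) - e (phi x)) ^+ 2 + s (phi x))%:E)%E].
Proof.
move=> mphi mX X01.
have [e [me e01 eX eX']] := cond_density_01 P mphi mX X01.
have mep : measurable_fun setT (e \o phi) by exact: measurableT_comp.
(* The residual (X - e)^2 is bounded too; its density is the variance term. *)
have mZ : measurable_fun setT (fun x => (X x - e (phi x)) ^+ 2).
  by apply: measurable_funX; exact: measurable_funB.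
have Z01 x : 0 <= (X x - e (phi x)) ^+ 2 <= 1.
  rewrite sqr_ge0 /= -real_normK ?num_real// expr_le1//.
  have /andP[? ?] := X01 x; have /andP[? ?] := e01 (phi x).
  by rewrite ler_norml; lra.
have [s [ms s0 sZ]] := cond_density P mphi mZ Z01.
exists e, s; split=> // [A mA|m A mm mA]; first exact: is_cond_density_integral.
have mpA : measurable (phi @^-1` A) by exact: measurable_preimage.
pose K := (\int[P]_(x in phi @^-1` A) (X x * (1 - X x))%:E)%E.
have key (n : T' -> R) : measurable_fun setT n ->
    (\int[P]_(x in phi @^-1` A) ((X x - n (phi x)) ^+ 2)%:E + K =
     \int[P]_(x in phi @^-1` A) ((e (phi x) - n (phi x)) ^+ 2)%:E +
     \int[P]_(x in phi @^-1` A) (e (phi x) * (1 - e (phi x)))%:E)%E.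
  move=> mn; have mnp : measurable_fun setT (n \o phi) by exact: measurableT_comp.
  rewrite (@square_split_integral _ _ _ P X (n \o phi))//.
  rewrite (@square_split_integral _ _ _ P (e \o phi) (n \o phi))//;
    last by move=> x; exact: e01.
  congr (_ + _)%E.
    apply: (eX (fun y => ((1 - n y) ^+ 2)%:E)) => //.
      by move=> y; rewrite lee_fin sqr_ge0.
    by apply/measurable_EFinP/measurable_funX; exact: measurable_funB.
  apply: (eX' (fun y => (n y ^+ 2)%:E)) => //.
    by move=> y; rewrite lee_fin sqr_ge0.
  by apply/measurable_EFinP/measurable_funX.
have K_fin : K \is a fin_num.
  apply: integrable_fin_num => //; apply: measurable_bounded_integrable => //.
  - by rewrite ltey_eq fin_num_measure.
  - by apply: measurable_funTS; apply: measurable_funM => //;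
      exact: measurable_funB.
  - exists 1; split=> [|M M1 x _]; first exact: num_real.
    apply: le_trans (ltW M1); have /andP[? ?] := X01 x.
    by rewrite ger0_norm ?mulr_ge0 ?mulr_ile1 ?subr_ge0//; lra.
have e_e0 : (\int[P]_(x in phi @^-1` A) ((e (phi x) - e (phi x)) ^+ 2)%:E = 0)%E.
  by apply: integral0_eq => x _; rewrite subrr expr0n.
have := key m mm; have := key e me; rewrite e_e0 add0e => <-.
rewrite addeA => /(congr1 (fun z => z - K)%E).
rewrite !addeK// => ->.
rewrite (is_cond_density_integral sZ)// -ge0_integralD//.
- by apply: eq_integral => x _; rewrite -EFinD -sqrrN opprB.
- by move=> w _; rewrite lee_fin sqr_ge0.
- apply/measurable_EFinP/measurable_funTS/measurable_funX.
  by apply: measurable_funB => //; exact: measurableT_comp.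
- by move=> w _; rewrite lee_fin.
- by apply/measurable_EFinP/measurable_funTS; exact: measurableT_comp.
Qed.

(** Conditioning on G is conditioning along the identity, seen as a map into the
    same space with the coarser sigma-algebra. *)
Lemma sub_measurable_id d (Omega : measurableType d) (G : set (set Omega)) :
  sigma_algebra setT G -> G `<=` measurable ->
  measurable_fun setT (id : Omega -> g_sigma_algebraType G).
Proof.
move=> sG GM _ A mA; rewrite setTI; apply: GM.
by rewrite -(sigma_algebra_id sG).
Qed.

(** Choosing a version is harmless: the chosen conditional expectation exists
    as soon as some real-valued version does, and agrees with it almost
    everywhere. *)
Lemma cond_expE d (Omega : measurableType d) (R : realType)
    (P : probability Omega R) (G : set (set Omega))
    (X : Omega -> \bar R) (r : Omega -> R) :
  sigma_algebra setT G -> G `<=` measurable ->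
  sub_measurable G r ->
  (forall A, G A -> (\int[P]_(w in A) X w = \int[P]_(w in A) (r w)%:E)%E) ->
  sub_measurable G (cond_exp P G X) /\
  {ae P, forall w, cond_exp P G X w = (r w)%:E}.
Proof.
move=> sG GM mr Xr.
have [mY YX] : is_cond_exp P G X (cond_exp P G X).
  apply: (@xgetPex _ (cst 0%E) [set Y | is_cond_exp P G X Y]).
  exists (EFin \o r); split=> [|A GA]; last by rewrite Xr.
  exact/measurable_EFinP.
split=> //.
apply: (@factor_ae_eq _ _ _ (g_sigma_algebraType G) _ P id) => //.
  exact: sub_measurable_id.
move=> A mA; have GA : G A by rewrite -(sigma_algebra_id sG).
by rewrite preimage_id YX// Xr.
Qed.

Lemma cond_exp_bias_variance d (Omega : measurableType d) (R : realType)
    (P : probability Omega R) (G : set (set Omega)) (X : Omega -> R) :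
  sigma_algebra setT G -> G `<=` measurable ->
  measurable_fun setT X -> (forall w, 0 <= X w <= 1) ->
  sub_measurable G (cond_exp P G (EFin \o X)) /\
  exists e s : Omega -> R,
    {ae P, forall w, cond_exp P G (EFin \o X) w = (e w)%:E} /\
    forall m : Omega -> R, sub_measurable G m ->
      {ae P, forall w, cond_exp P G (fun w => ((X w - m w) ^+ 2)%:E) w =
        ((m w - e w) ^+ 2 + s w)%:E}.
Proof.
move=> sG GM mX X01.
have mid := sub_measurable_id sG GM.
have [e [s [me ms Xe Xms]]] := bias_variance P mid mX X01.
have GE A : G A -> measurable (A : set (g_sigma_algebraType G)).
  by move=> GA; exact: sub_sigma_algebra.
have [mE Ee] := @cond_expE _ _ _ P G (EFin \o X) e sG GM me
  (fun A GA => Xe A (GE A GA)).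
split=> //; exists e, s; split=> // m mm.
have mme : measurable_fun setT
    (fun w : g_sigma_algebraType G => (m w - e w) ^+ 2 + s w).
  by apply: measurable_funD => //; apply: measurable_funX; exact: measurable_funB.
by have [_] := @cond_expE _ _ _ P G (fun w => ((X w - m w) ^+ 2)%:E) _ sG GM mme
  (fun A GA => Xms m A mm (GE A GA)).
Qed.

(** * The optimization problem *)

(** Pythagoras: (g / Q) b is the point of the hyperplane sum_v n_v g_v = b which
    is closest to the origin, and is orthogonal to the hyperplane. *)
Lemma sum_sqr_hyperplane (R : realFieldType) (V : finType) (S : {set V})
    (g n : V -> R) (b : R) :
  let Q := \sum_(v in S) g v ^+ 2 in
  Q != 0 -> \sum_(v in S) n v * g v = b ->
  \sum_(v in S) n v ^+ 2 =
    \sum_(v in S) (n v - g v / Q * b) ^+ 2 + \sum_(v in S) (g v / Q * b) ^+ 2.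
Proof.
move=> Q Q0 nb; rewrite -big_split /=.
transitivity (\sum_(v in S) (n v ^+ 2 - 2 * b / Q * (n v * g v)
                             + 2 * b ^+ 2 / Q ^+ 2 * g v ^+ 2)); last first.
  by apply: eq_bigr => v _; field.
rewrite 2!big_split /= sumrN -!mulr_sumr nb -/Q.
by field.
Qed.

Section optimality.
Context d (Omega : measurableType d) (R : realType) (P : probability Omega R).
Context (G : set (set Omega)) (V : finType) (S : {set V}).
Context (X : V -> Omega -> R) (g : V -> R) (f : Omega -> R).
Hypothesis sG : sigma_algebra setT G.
Hypothesis GM : G `<=` measurable.
Hypothesis mX : forall v, v \in S -> measurable_fun setT (X v).
Hypothesis X01 : forall v w, v \in S -> 0 <= X v w <= 1.
Hypothesis mf : sub_measurable G f.

Let Q := \sum_(v in S) g v ^+ 2.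
Hypothesis Q0 : Q != 0.

Let EX v w := fine (cond_exp P G (fun w' => (X v w')%:E) w).
Let mopt v w := EX v w + g v / Q * (f w - \sum_(c in S) g c * EX c w).

Let mEX v : v \in S -> sub_measurable G (EX v).
Proof.
move=> vS.
have [mE _] := @cond_exp_bias_variance _ _ _ P G (X v) sG GM (mX vS)
  (fun w => X01 w vS).
by rewrite /EX /sub_measurable; exact: measurableT_comp mE.
Qed.

Let mopt_feasible : feasible P G S g f mopt.
Proof.
split=> [v vS|].
  apply: measurable_funD; first exact: mEX.
  apply: measurable_funM => //; apply: measurable_funB => //.
  have -> : (fun w => \sum_(c in S) g c * EX c w) =
      fun w => \sum_c (if c \in S then g c * EX c w else 0).
    by apply/funext => w; rewrite big_mkcond.
  apply: measurable_sum => c; case: (boolP (c \in S)) => [cS|_];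
    last exact: measurable_cst.
  by apply: measurable_funM => //; exact: mEX.
apply: aeW => w.
pose b := f w - \sum_(c in S) g c * EX c w.
rewrite /mopt -/b; under eq_bigr do rewrite mulrDl.
rewrite big_split /=.
transitivity (\sum_(v in S) g v * EX v w + \sum_(v in S) (b / Q) * g v ^+ 2).
  by rewrite -mulr_sumr -/Q divfK// addrC subrK.
congr (_ + _); apply: eq_bigr => v _; first exact: mulrC.
by field.
Qed.

(** On the outcomes where the constraint holds for [m], bias-variance turns both
    objectives into squared distances to the conditional means, up to a common
    term; [o] is the finite value of the objective at [mopt]. *)
Let objective_excess m : feasible P G S g f m -> exists o : Omega -> R,
  {ae P, forall w,
    objective P G S X mopt w = (o w)%:E /\
    objective P G S X m w = (\sum_(v in S) (m v w - mopt v w) ^+ 2 + o w)%:E}.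
Proof.
move=> [mm fm].
have /choice[es esP] : forall v, exists es : (Omega -> R) * (Omega -> R),
    v \in S ->
    {ae P, forall w, cond_exp P G (fun w => (X v w)%:E) w = (es.1 w)%:E} /\
    forall n : Omega -> R, sub_measurable G n ->
      {ae P, forall w, cond_exp P G (fun w => ((X v w - n w) ^+ 2)%:E) w =
        ((n w - es.1 w) ^+ 2 + es.2 w)%:E}.
  move=> v; case: (boolP (v \in S)) => vS; last by exists (cst 0, cst 0).
  have [_ [e [s es]]] := @cond_exp_bias_variance _ _ _ P G (X v) sG GM (mX vS)
    (fun w => X01 w vS).
  by exists (e, s).
have allS (Y : Omega -> V -> Prop) :
    (forall v, v \in S -> {ae P, forall w, Y w v}) ->
    {ae P, forall w, forall v, v \in S -> Y w v}.
  move=> YP; apply: filter_forall => v.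
  case: (boolP (v \in S)) => vS; last exact: aeW.
  by apply: filterS (YP v vS) => w Yw _.
have aeE := allS _ (fun v vS => (esP v vS).1).
have aem := allS _ (fun v vS => (esP v vS).2 _ (mm v vS)).
have aeo := allS _ (fun v vS => (esP v vS).2 _ (mopt_feasible.1 v vS)).
pose e v w := (es v).1 w; pose s v w := (es v).2 w.
exists (fun w => \sum_(v in S) ((mopt v w - e v w) ^+ 2 + s v w)).
apply: (filter_app _ _ aeE); apply: filterS3 aem aeo fm => w hm ho fw hE.
split.
  by rewrite -sumEFin; apply: eq_bigr => v vS; exact: ho.
have EXe v : v \in S -> EX v w = e v w by move=> vS; rewrite /EX hE.
rewrite /objective.
rewrite (eq_bigr (fun v => ((m v w - e v w) ^+ 2 + s v w)%:E)); last first.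
  by move=> v vS; exact: hm.
rewrite sumEFin !big_split /=; congr EFin; rewrite addrA; congr (_ + _).
pose b := f w - \sum_(c in S) g c * e c w.
have bE : f w - \sum_(c in S) g c * EX c w = b.
  by congr (_ - _); apply: eq_bigr => c cS; rewrite EXe.
rewrite (@sum_sqr_hyperplane _ V S g (fun v => m v w - e v w) b)//; last first.
  rewrite /b fw -sumrB; apply: eq_bigr => v _; rewrite mulrBl.
  by congr (_ - _); exact: mulrC.
by congr (_ + _); apply: eq_bigr => v vS; rewrite /mopt bE EXe// -/Q;
  congr (_ ^+ 2); ring.
Qed.

(** The excess over the optimal value is a sum of squares: it is nonnegative,
    and vanishes only at [mopt]. *)
Lemma optimal_affine_correction :
  optimal P G S X g f mopt /\
  (forall m, optimal P G S X g f m ->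
     forall v, v \in S -> {ae P, forall w, m v w = mopt v w}).
Proof.
split.
  split; first exact: mopt_feasible.
  move=> m mF; have [c cP] := objective_excess mF.
  apply: filterS cP => w [-> ->].
  by rewrite lee_fin lerDr sumr_ge0// => v _; exact: sqr_ge0.
move=> m [mF mmin] v vS; have [c cP] := objective_excess mF.
move: cP (mmin _ mopt_feasible); apply: filterS2 => w [-> ->].
rewrite lee_fin gerDr => d_le0.
have d_eq0 : \sum_(v in S) (m v w - mopt v w) ^+ 2 = 0.
  by apply/eqP; rewrite eq_le d_le0 sumr_ge0// => u _; exact: sqr_ge0.
have := psumr_eq0P (fun u _ => sqr_ge0 (m u w - mopt u w)) d_eq0 vS.
by move/eqP; rewrite sqrf_eq0 subr_eq0 => /eqP.
Qed.

End optimality.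

(** * Positivity of the scaling factors *)

Lemma in_arc_unique (N : network) (l l' : arcs N) :
  arc_end l = arc_end l' -> l = l'.
Proof.
move=> ll'; have /eqP/cards1P[a aP] := unique_in (source_no_in l).
have : l \in [set a]%SET by rewrite -aP inE.
have : l' \in [set a]%SET by rewrite -aP inE ll'.
by rewrite !inE => /eqP-> /eqP->.
Qed.

Lemma descends_arc (N : network) (l : arcs N) :
  descends (arc_start l) (arc_end l).
Proof. by apply: connect1; apply/existsP; exists l; rewrite !eqxx. Qed.

(** In-arcs being unique, the predecessor of a node on a cycle is on that cycle.
    Going backwards along a path from the source, a cycle would therefore pass
    through the source, which has no in-arc. *)
Lemma no_cycle (N : network) (l : arcs N) :
  ~~ descends (arc_end l) (arc_start l).
Proof.
pose cyclic v := exists2 a : arcs N, arc_end a = v & descends v (arc_start a).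
suff noncyclic : forall v, ~ cyclic v.
  by apply/negP => h; apply: (noncyclic (arc_end l)); exists l.
have step (u v : nodes N) : Defs.adjacent (@arc_start N) (@arc_end N) u v ->
    ~ cyclic u -> ~ cyclic v.
  move=> /existsP[b /andP[/eqP bu /eqP bv]] ncu [a av va]; apply: ncu.
  have ab : a = b by apply: in_arc_unique; rewrite av bv.
  subst a; rewrite bu in va.
  case: (eqVneq u (source N)) => [us|us].
    (* The way back from v would enter the source. *)
    case: (eqVneq v u) => [vu|vu].
      by have := source_no_in b; rewrite bv vu us eqxx.
    have /connectP[p] := va; case/lastP: p => [|p x].
      by move=> _ /= /eqP; rewrite eq_sym (negbTE vu).
    rewrite rcons_path last_rcons => /andP[_ /existsP[c /andP[_ /eqP cx]]] ux.
    by have := source_no_in c; rewrite cx -ux us eqxx.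
  have /eqP/cards1P[c cP] := unique_in us.
  have cu : arc_end c = u.
    by have : c \in [set c]%SET; [rewrite inE|rewrite -cP inE => /eqP].
  exists c => //.
  have uv : descends u v by rewrite -bu -bv descends_arc.
  apply: connect_trans uv _.
  have /connectP[p] := va; case/lastP: p => [_ /= uv'|p x].
    (* Here v = u, so that the arc b is a loop. *)
    have <- : b = c by apply: in_arc_unique; rewrite bv cu.
    by rewrite bu uv' connect0.
  rewrite rcons_path last_rcons.
  move=> /andP[pp /existsP[c' /andP[/eqP c's /eqP c'x]]] ux.
  have <- : c' = c by apply: in_arc_unique; rewrite c'x cu.
  by apply/connectP; exists p.
move=> v; have /connectP[p pp ->] := from_source v.
have : ~ cyclic (source N).
  by case=> a as_; have := source_no_in a; rewrite as_ eqxx.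
elim: p (source N) pp => //= u p IH w /andP[wu pp] ncw.
by apply: IH => //; exact: step wu ncw.
Qed.

(** A descendant of the given node with as few descendants as possible is a leaf:
    otherwise the end of an out-arc would have fewer, as it does not lead
    back. *)
Lemma demand_below_nonempty (N : network) (i : arcs N) :
  exists v, v \in demand_below (arc_end i).
Proof.
pose below (v : nodes N) := [set u | descends v u]%SET.
have [v iv vmin] := @arg_minnP _ (arc_end i) (descends (arc_end i))
  (fun v => #|below v|) (connect0 _ _).
exists v; rewrite !inE iv andbT; apply/andP; split.
  apply/eqP => vs; have /connectP[p] := iv; case/lastP: p => [_ /= vi|p x].
    by have := source_no_in i; rewrite -vi vs eqxx.
  rewrite rcons_path last_rcons => /andP[_ /existsP[c /andP[_ /eqP cx]]] vx.
  by have := source_no_in c; rewrite cx -vx vs eqxx.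
apply/negP => /existsP[l /eqP lv].
have lv' : descends v (arc_end l) by rewrite -lv descends_arc.
have := vmin _ (connect_trans iv lv'); apply/negP; rewrite -ltnNge.
apply: proper_card; apply/properP; split.
  by apply/fintype.subsetP => u; rewrite !inE => /(connect_trans lv').
exists v; rewrite !inE; first exact: connect0.
by rewrite -lv no_cycle.
Qed.

Lemma travel_time_monotone (R : realType) (N : network) (lam : arcs N -> R -> R)
    (ttime : nodes N -> nodes N -> R -> R) (v u w : nodes N) (t : R) :
  travel_times lam ttime v t -> descends v u -> descends u w ->
  ttime v u t <= ttime v w t.
Proof.
move=> [_ tl] vu /connectP[p pp ->] {w}.
elim: p u vu pp => //= x p IH u vu /andP[/existsP[l /andP[/eqP lu /eqP lx]] pp].
have vl : descends v (arc_start l) by rewrite lu.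
have [ux _] := tl l vl; rewrite -lu.
apply: le_trans ux _; rewrite lx; apply: IH => //.
by apply: connect_trans vl _; rewrite -lx; exact: descends_arc.
Qed.

Lemma travel_time_in_range (R : realType) (N : network) (lam : arcs N -> R -> R)
    (ttime : nodes N -> nodes N -> R -> R) (v u w : nodes N) (t0 T t : R) :
  travel_times lam ttime v t -> t0 <= t ->
  descends v u -> descends u w -> ttime v w t <= T ->
  ttime v u t \in `[t0, T].
Proof.
move=> tt t0t vu uw wT; rewrite in_itv /=; apply/andP; split.
  apply: le_trans t0t _; rewrite -{1}(tt.1).
  by apply: (travel_time_monotone tt) => //; exact: connect0.
by apply: le_trans wT; exact: travel_time_monotone tt vu uw.
Qed.

Lemma gamma_gt0 (R : realType) (N : network) (t0 T t : R)
    (lam mu : arcs N -> R -> R) (ttime : nodes N -> nodes N -> R -> R)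
    (v w : nodes N) :
  (forall l, velocity t0 T (lam l)) ->
  travel_times lam ttime v t -> t0 <= t -> ttime v w t <= T ->
  0 < gamma lam mu ttime v w t.
Proof.
move=> lamP tt t0t wT; apply: prodr_gt0 => l; rewrite inE => /andP[vl lw].
have [_ lam_gt0 _] := lamP l.
have ll := descends_arc l.
rewrite mulr_gt0 ?expR_gt0// divr_gt0//; apply: lam_gt0.
- exact: (travel_time_in_range tt t0t vl (connect_trans ll lw) wT).
- exact: (travel_time_in_range tt t0t (connect_trans vl ll) lw wT).
Qed.

Theorem lemma5p1 (R : realType) (N : network) (t0 T : R)
  (lam mu : arcs N -> R -> R)
  (d : measure_display) (Omega : measurableType d) (P : probability Omega R)
  (F : R -> set (set Omega))
  (z : arcs N -> Omega -> R -> R -> R)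
  (kappa sigma : nodes N -> R) (theta : nodes N -> R -> R)
  (W D : nodes N -> R -> Omega -> R)
  (k : nat) (that : nat -> R)
  (ttime : nodes N -> nodes N -> R -> R)
  (i : arcs N) (j : nat) (t : R)
  (lamP : forall l, velocity t0 T (lam l))
  (muP : forall l, damping t0 T (mu l))
  (FP : filtration t0 T F)
  (zP : {ae P, forall w, forall l, density t0 T (lam l) (mu l) (z l w)})
  (kappa_gt0 : forall v, v \in demand_nodes N -> 0 < kappa v)
  (sigma_gt0 : forall v, v \in demand_nodes N -> 0 < sigma v)
  (WP : forall v, v \in demand_nodes N -> brownian P t0 T F (W v))
  (DP : forall v, v \in demand_nodes N ->
    jacobi_process P t0 T F (kappa v) (sigma v) (theta v) (W v) (D v))
  (that1 : that 1%N = t0)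
  (that_lt : forall a, (1 <= a < k)%N -> that a < that a.+1)
  (thatk : that k <= T)
  (vi_inner : arc_end i \in inner_nodes N)
  (hj : (1 <= j < k)%N)
  (ht : t \in `[that j, that j.+1])
  (ttimeP : travel_times lam ttime (arc_end i) t)
  (ttime_le : forall v, v \in demand_below (arc_end i) ->
    ttime (arc_end i) v t <= T)
  (finP : sub_measurable (F (that j)) (fun w => flux (lam i) (z i w 1 t) t)) :
  let vi := arc_end i in
  let G := F (that j) in
  let S := demand_below vi in
  let fin := fun w => flux (lam i) (z i w 1 t) t in
  let g := fun v => gamma lam mu ttime vi v t in
  let X := fun v => D v (ttime vi v t) in
  let EX := fun v w => fine (cond_exp P G (fun w' => (X v w')%:E) w) in
  let mopt := fun v w =>
    EX v w + g v / (\sum_(c in S) g c ^+ 2) *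
             (fin w - \sum_(c in S) g c * EX c w) in
  optimal P G S X g fin mopt /\
  (forall m, optimal P G S X g fin m ->
     forall v, v \in S -> {ae P, forall w, m v w = mopt v w}).
Proof.
move=> vi G S fin g X EX mopt.
have /andP[j1 jk] := hj.
have upd_le a b : (1 <= a)%N -> (a <= b <= k)%N -> that a <= that b.
  move=> a1 /andP[ab]; rewrite -(subnKC ab); elim: (b - a)%N => [|c IH] abk.
    by rewrite addn0.
  rewrite addnS in abk *; apply: le_trans (IH (ltnW abk)) _.
  by apply: ltW; apply: that_lt; rewrite abk (leq_trans a1) ?leq_addr.
have t0j : t0 <= that j by rewrite -that1 upd_le// j1 ltnW.
have jT : that j.+1 <= T by apply: le_trans thatk; rewrite upd_le// jk leqnn.
move: ht; rewrite in_itv /= => /andP[jt tj].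
have t0t : t0 <= t by exact: le_trans jt.
have tT : t <= T by exact: le_trans jT.
have jT0 : that j \in `[t0, T] by rewrite in_itv /= t0j (le_trans jt).
have [sF FM _] := FP.
have Sd v : v \in S -> v \in demand_nodes N /\ descends vi v.
  by rewrite inE => /andP[].
have Xt v : v \in S -> ttime vi v t \in `[t0, T].
  move=> vS; have [_ vd] := Sd v vS.
  exact: (travel_time_in_range ttimeP t0t vd (connect0 _ v) (ttime_le _ vS)).
apply: (@optimal_affine_correction _ Omega R P G _ S X g fin) => //.
- exact: sF.
- exact: FM.
- move=> v vS; have [vd _] := Sd v vS; have [ad _ _ _ _] := DP v vd.
  move=> _ A mA; apply: (FM _ (Xt v vS)).
  have := ad _ (Xt v vS) measurableT A mA.
  by rewrite /measurable /= (sigma_algebra_id (sF _ (Xt v vS))).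
- move=> v w vS; have [vd _] := Sd v vS; have [_ _ D01 _ _] := DP v vd.
  exact: D01 (Xt v vS).
- have [v vS] := demand_below_nonempty i.
  rewrite gt_eqF// (bigD1 v)//= ltr_wpDr//.
    by apply: sumr_ge0 => u _; exact: sqr_ge0.
  by rewrite exprn_gt0// (gamma_gt0 mu lamP ttimeP t0t (ttime_le _ vS)).
Qed.
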